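(* Let $(M,d)$ be a complete cone metric space over a real Banach space $E$ with cone $P$, where $P$ is a normal cone with normal constant $K$. Let $T: M\to M$ be a continuous and one-to-one mapping and let $S: M\to M$ be a continuous $T$-weak contraction. Then: (i) For every $x_0\in M$, $\lim_{n\to\infty} d(TS^nx_0, TS^{n+1}x_0)=0$. (ii) For every $x_0\in M$ there is $y_0\in M$ such that $\lim_{n\to\infty} TS^nx_0=y_0$. (iii) If $T$ is subsequentially convergent, then for every $x_0\in M$ the sequence $(S^nx_0)$ has a convergent subsequence. (iv) There is $z_0\in M$ such that $Sz_0=z_0$. (v) If $T$ is sequentially convergent, then for each $x_0\in M$ the iterate sequence $(S^nx_0)$ converges to $z_0$ (the point in (iv)).
   Context: Let $E$ be a real Banach space. A subset $P\subset E$ is a cone if: $P$ is closed, nonempty and $P\neq\{0\}$; $ax+by\in P$ for all $x,y\in P$ and real $a,b\ge 0$; and $P\cap(-P)=\{0\}$. Throughout, the interior $\operatorname{Int}P$ is assumed nonempty. The partial order on $E$ is $x\le y$ iff $y-x\in P$; $x<y$ means $x\le y$ and $x\ne y$; $x\ll y$ means $y-x\in\operatorname{Int}P$. The cone $P$ is normal if there is $K>0$ such that $0\le x\le y$ implies $\|x\|\le K\|y\|$ for all $x,y\in E$; the least such $K$ is the normal constant of $P$. A cone metric on a nonempty set $M$ is a map $d:M\times M\to E$ such that for all $x,y,z\in M$: $0\le d(x,y)$, and $d(x,y)=0$ iff $x=y$; $d(x,y)=d(y,x)$; $d(x,y)\le d(x,z)+d(z,y)$. Then $(M,d)$ is a cone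 metric space. A sequence $(x_n)$ in $M$ converges to $x\in M$ (written $\lim_{n\to\infty}x_n=x$) if for every $c\in E$ with $0\ll c$ there is $n_0$ such that $d(x_n,x)\ll c$ for all $n>n_0$; it is Cauchy if for every $c\in E$ with $0\ll c$ there is $n_0$ such that $d(x_n,x_m)\ll c$ for all $n,m\ge n_0$. $(M,d)$ is complete if every Cauchy sequence in $M$ converges in $M$. Limits of sequences in $E$ are in norm. A mapping $T:M\to M$ is continuous if $\lim_n x_n=x$ implies $\lim_n Tx_n=Tx$ for all sequences $(x_n)$ and points $x$ in $M$. $T$ is subsequentially convergent if for every sequence $(y_n)$ in $M$, whenever $(Ty_n)$ is convergent, $(y_n)$ has a convergent subsequence. $T$ is sequentially convergent if for every sequence $(y_n)$ in $M$, whenever $(Ty_n)$ is convergent, $(y_n)$ is convergent. For mappings $T,S:M\to M$, write $TSx=T(S(x))$, and let $S^n$ be the $n$-th iterate of $S$. $S$ is a $T$-weak contraction if there exist a constant $\delta\in(0,1)$ and some $L\ge 0$ such that $d(TSx,TSy)\le \delta\, d(Tx,Ty)+L\, d(Ty,TSx)$ for all $x,y\in M$.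
   Formalization: Part (iv) is proved assuming T is subsequentially convergent (it fails otherwise: M=[0,∞), Tx=1/(1+x), Sx=2x+1), and in (v) the fixed point z_0 may depend on x_0 (a common z_0 fails for T=S=id, L=1). *)

(* Defs.v *)
From HB Require Import structures.
From mathcomp Require Import all_boot all_order all_algebra.
From mathcomp Require Import all_classical all_reals all_analysis.

Set Implicit Arguments.
Unset Strict Implicit.
Unset Printing Implicit Defensive.

Import Order.TTheory GRing.Theory Num.Theory.
Import numFieldNormedType.Exports.

Local Open Scope classical_set_scope.
Local Open Scope ring_scope.

Section Cones.
Context {R : realType} {E : completeNormedModType R}.
Implicit Types (P : set E) (K : R).

Definition is_cone P : Prop :=
  [/\ closed P,
      P !=set0 /\ P <> [set 0],
      forall (a b : R) (x y : E), 0 <= a -> 0 <= b -> P x -> P y ->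
        P (a *: x + b *: y)
    & forall x : E, P x /\ P (- x) <-> x = 0].

Definition cone_le P (x y : E) : Prop := P (y - x).

Definition cone_ll P (x y : E) : Prop := interior P (y - x).

Definition normality_bound P : set R :=
  [set K | 0 < K /\ forall x y : E,
    cone_le P 0 x -> cone_le P x y -> `|x| <= K * `|y|].

Definition normal_cone P : Prop := normality_bound P !=set0.

Definition normal_constant P K : Prop :=
  normality_bound P K /\ lbound (normality_bound P) K.

End Cones.

Section ConeMetric.
Context {R : realType} {E : completeNormedModType R} {M : Type}.
Variables (P : set E) (d : M -> M -> E).
Implicit Types (u : nat -> M) (x y z : M) (T S : M -> M).

Definition is_cone_metric : Prop :=
  [/\ forall x y, cone_le P 0 (d x y),
      forall x y, d x y = 0 <-> x = y,
      forall x y, d x y = d y x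
    & forall x y z, cone_le P (d x y) (d x z + d z y)].

Definition cone_cvg_to u x : Prop :=
  forall c : E, cone_ll P 0 c ->
    exists n0 : nat, forall n : nat, (n0 < n)%N -> cone_ll P (d (u n) x) c.

Definition cone_cvg u : Prop := exists x, cone_cvg_to u x.

Definition cone_cauchy u : Prop :=
  forall c : E, cone_ll P 0 c ->
    exists n0 : nat, forall n m : nat, (n0 <= n)%N -> (n0 <= m)%N ->
      cone_ll P (d (u n) (u m)) c.

Definition cone_complete : Prop := forall u, cone_cauchy u -> cone_cvg u.

Definition cone_continuous T : Prop :=
  forall u x, cone_cvg_to u x -> cone_cvg_to (T \o u) (T x).

Definition has_cvg_subsequence u : Prop :=
  exists2 phi : nat -> nat,
    {homo phi : m n / (m < n)%N} & cone_cvg (u \o phi).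

Definition subsequentially_convergent T : Prop :=
  forall u, cone_cvg (T \o u) -> has_cvg_subsequence u.

Definition sequentially_convergent T : Prop :=
  forall u, cone_cvg (T \o u) -> cone_cvg u.

Definition weak_contraction T S : Prop :=
  exists delta L : R, [/\ 0 < delta < 1, 0 <= L &
    forall x y, cone_le P (d (T (S x)) (T (S y)))
      (delta *: d (T x) (T y) + L *: d (T y) (T (S x)))].

End ConeMetric.

(* Main.v *)
Require Import Defs.
From mathcomp Require Import all_boot all_order all_algebra.
From mathcomp Require Import all_classical all_reals all_analysis.
From mathcomp Require Import ring.

Import Order.TTheory GRing.Theory Num.Theory.
Import numFieldNormedType.Exports.

Local Open Scope classical_set_scope.
Local Open Scope ring_scope.

(** Feeding two consecutive iterates to the weak contraction inequality kills
    its second term: [L *: d (T y) (T (S x))] vanishes when [y = S x].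
    Hence, along an orbit [x n = iter n S x0], the inequality is an ordinary
    contraction, and the steps of the image sequence satisfy
      [d (T (x n)) (T (x n.+1)) <= delta ^+ n *: d (T x0) (T (S x0))]
    in the order of the cone ([weak_contraction_orbit]).

    Part (i) follows because normality turns an order bound by a norm-null
    sequence into norm convergence to [0] ([normal_cone_squeeze0]). For part
    (ii), summing the geometric series bounds [d (T (x n)) (T (x m))] by a
    norm-null sequence, which drops below every interior point of the cone
    ([cone_cauchy_geometric]), and completeness applies. Part (iii) is then
    subsequential convergence of [T] applied to the orbit.

    For (iv) and (v), let a subsequence of the orbit tend to [z]. By continuity
    [T z] and [T (S z)] are limits of two subsequences of the convergent
    sequence [T (x n)], so they agree by uniqueness of limits
    ([cone_cvg_to_unique]), and injectivity of [T] gives [S z = z]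
    ([orbit_limit_fixed]). A weak contraction may have several fixed points; the
    limit in (v) may depend on the starting point. *)

(** * The order defined by a cone *)

Section ConeOrder.
Context {R : realType} {E : completeNormedModType R} {P : set E}.
Hypothesis coneP : is_cone P.
Implicit Types (x y z c a : E) (k : R).

Lemma coneD x y : P x -> P y -> P (x + y).
Proof.
case: coneP => _ _ lin _ Px Py.
by rewrite -(scale1r x) -(scale1r y); apply: lin.
Qed.

Lemma coneZ k x : 0 <= k -> P x -> P (k *: x).
Proof.
case: coneP => _ _ lin _ k0 Px.
by have := lin _ _ _ _ k0 (lexx 0) Px Px; rewrite scale0r addr0.
Qed.

Lemma cone0 : P 0.
Proof. by case: coneP => _ _ _ /(_ 0) [_ /(_ erefl)] []. Qed.

Lemma cone_anti x : P x -> P (- x) -> x = 0.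
Proof. by case: coneP => _ _ _ /(_ x) [+ _] Px PNx; apply. Qed.

Lemma cone_le_refl x : cone_le P x x.
Proof. by rewrite /cone_le subrr; exact: cone0. Qed.

Lemma cone_le_trans y x z : cone_le P x y -> cone_le P y z -> cone_le P x z.
Proof.
by move=> xy yz; have := coneD _ _ yz xy; rewrite /cone_le addrA subrK.
Qed.

Lemma cone_leD x y z a :
  cone_le P x y -> cone_le P z a -> cone_le P (x + z) (y + a).
Proof. by move=> xy za; rewrite /cone_le opprD addrACA; exact: coneD. Qed.

Lemma cone_leZ k x y : 0 <= k -> cone_le P x y -> cone_le P (k *: x) (k *: y).
Proof. by move=> k0 xy; rewrite /cone_le -scalerBr; exact: coneZ. Qed.

(** An interior point stays interior after translation by an element of the
    cone, because the cone absorbs its own translates. *)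
Lemma interior_coneD x y : interior P x -> P y -> interior P (x + y).
Proof.
move=> Px Py; rewrite /interior/=.
have cvgx : z - y @[z --> x + y] --> x.
  rewrite -[X in _ --> X](addrK y x).
  by apply: cvgB; [exact: cvg_id|exact: cvg_cst].
have : \forall z \near x + y, P (z - y) := cvgx _ Px.
by apply: filterS => z Pz; rewrite -(subrK y z); exact: coneD.
Qed.

Lemma interior_coneZ k x : 0 < k -> interior P x -> interior P (k *: x).
Proof.
move=> k0 Px; rewrite /interior/=.
have kN0 : k != 0 by rewrite gt_eqF.
have cvgx : k^-1 *: z @[z --> k *: x] --> x.
  rewrite -[X in _ --> X](scalerK kN0 x).
  by apply: cvgZ; [exact: cvg_cst|exact: cvg_id].
have : \forall z \near k *: x, P (k^-1 *: z) := cvgx _ Px.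
apply: filterS => z Pz; rewrite -(scalerKV kN0 z).
by apply: coneZ => //; exact: ltW.
Qed.

Lemma cone_le_ll_trans y x c :
  cone_le P x y -> cone_ll P y c -> cone_ll P x c.
Proof.
move=> xy yc; rewrite /cone_ll.
have -> : c - x = (c - y) + (y - x) by rewrite addrA subrK.
exact: interior_coneD.
Qed.

(** Closedness of the cone lets [k] tend to [0] in [P (k *: c - x)]. Multiples
    of a single [c] suffice, which is why one interior point of the cone is
    enough to separate limits. *)
Lemma cone_le0_of_small c x :
  (forall k, 0 < k -> cone_le P x (k *: c)) -> cone_le P x 0.
Proof.
move=> xc; have [clP _ _ _] := coneP.
have cv : k *: c - x @[k --> (0:R)^'+] --> 0 - x.
  apply: cvgB; last exact: cvg_cst.
  rewrite -[X in _ --> X](scale0r c).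
  by apply: cvgZ; [exact/cvg_at_right_filter/cvg_id|exact: cvg_cst].
apply: (closed_cvg P clP _ _ cv).
by near=> k; apply: xc; near: k; exact: nbhs_right_gt.
Unshelve. all: by end_near.
Qed.

(** As [c - u n] tends to [c] in norm, it eventually enters the open set
    [interior P]. This carries norm estimates over to the order. *)
Lemma cvg0_cone_ll (u : nat -> E) c :
  u n @[n --> \oo] --> (0 : E) -> cone_ll P 0 c ->
  \forall n \near \oo, cone_ll P (u n) c.
Proof.
rewrite /cone_ll subr0 => u0 Pc.
have cu : c - u n @[n --> \oo] --> c.
  by rewrite -[X in _ --> X]subr0; apply: cvgB => //; exact: cvg_cst.
by apply: cu; apply: open_nbhs_nbhs; split => //; exact: open_interior.
Qed.

End ConeOrder.

Lemma cvg_exprZ0 {R : realType} {E : completeNormedModType R} (delta : R)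
    (a : E) : 0 < delta < 1 -> delta ^+ n *: a @[n --> \oo] --> (0 : E).
Proof.
move=> /andP[d0 d1]; rewrite -[X in _ --> X](scale0r a).
by apply: cvgZ; [apply: cvg_expr; rewrite gtr0_norm|exact: cvg_cst].
Qed.

(** * Convergence in cone metric spaces *)

Section ConeMetricLimits.
Context {R : realType} {E : completeNormedModType R} {M : Type}.
Context {P : set E} {d : M -> M -> E}.
Hypotheses (coneP : is_cone P) (metric_d : is_cone_metric P d).
Implicit Types (u : nat -> M) (x y : M) (a : E).

(** Two limits lie within [k *: (c + c)] of each other for an interior point [c]
    and every [k > 0], so their distance is below [0] as well as above it. *)
Lemma cone_cvg_to_unique u x y : interior P !=set0 ->
  cone_cvg_to P d u x -> cone_cvg_to P d u y -> x = y.
Proof.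
case: metric_d => ge0 eq0 sym tri [c Pc] ux uy; apply/eq0.
apply: (cone_anti coneP); first by have := ge0 x y; rewrite /cone_le subr0.
suff : cone_le P (d x y) 0 by rewrite /cone_le sub0r.
apply: (cone_le0_of_small coneP (c + c)) => k k0.
have Pkc : cone_ll P 0 (k *: c).
  by rewrite /cone_ll subr0; exact: interior_coneZ.
have [n1 ux1] := ux _ Pkc; have [n2 uy2] := uy _ Pkc.
set n := (maxn n1 n2).+1.
have /ux1 uxn : (n1 < n)%N by rewrite ltnS leq_maxl.
have /uy2 uyn : (n2 < n)%N by rewrite ltnS leq_maxr.
apply: (cone_le_trans coneP _ _ _ (tri x y (u n))).
rewrite scalerDr (sym x).
by apply: (cone_leD coneP);
  [exact: interior_subset uxn|exact: interior_subset uyn].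
Qed.

Lemma cone_cvg_to_subseq u x (phi : nat -> nat) :
  {homo phi : m n / (m < n)%N} -> cone_cvg_to P d u x ->
  cone_cvg_to P d (u \o phi) x.
Proof.
move=> phiS ux c /ux [n0 un0]; exists n0 => n n0n; apply: un0.
apply: leq_trans n0n _; elim: n => // n IH.
by apply: leq_ltn_trans IH _; exact: phiS.
Qed.

Lemma cone_cvg_to_shift u x :
  cone_cvg_to P d u x -> cone_cvg_to P d (u \o succn) x.
Proof. by apply: cone_cvg_to_subseq => m n. Qed.

Lemma cone_dist_geometric u a delta : 0 < delta < 1 -> cone_le P 0 a ->
  (forall n, cone_le P (d (u n) (u n.+1)) (delta ^+ n *: a)) ->
  forall n k, cone_le P (d (u n) (u (n + k)%N))
                (delta ^+ n *: ((1 - delta)^-1 *: a)).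
Proof.
case: metric_d => _ eq0 _ tri /andP[d0 d1] a0 ua n k.
have d1N0 : 1 - delta != 0 by rewrite gt_eqF// subr_gt0.
elim: k n => [n|k IH n].
  have /eq0 -> : u n = u (n + 0)%N by rewrite addn0.
  rewrite /cone_le subr0; apply: coneZ => //; first exact/exprn_ge0/ltW.
  apply: coneZ => //; first by rewrite invr_ge0 subr_ge0 ltW.
  by move: a0; rewrite /cone_le subr0.
apply: (cone_le_trans coneP _ _ _ (tri _ _ (u n.+1))).
(* The bound is a fixed point of the recursion: 1 + delta / (1 - delta) equals
   1 / (1 - delta). *)
have -> : delta ^+ n *: ((1 - delta)^-1 *: a) =
    delta ^+ n *: a + delta ^+ n.+1 *: ((1 - delta)^-1 *: a).
  rewrite !scalerA -scalerDl; congr (_ *: _).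
  by rewrite exprS; field.
by apply: (cone_leD coneP) => //; rewrite addnS -addSn; exact: IH.
Qed.

Lemma cone_cauchy_geometric u a delta : 0 < delta < 1 -> cone_le P 0 a ->
  (forall n, cone_le P (d (u n) (u n.+1)) (delta ^+ n *: a)) ->
  cone_cauchy P d u.
Proof.
move=> d01 a0 ua c Pc; have [_ _ sym _] := metric_d.
have [n0 _ un0] :=
  cvg0_cone_ll _ _ (cvg_exprZ0 _ ((1 - delta)^-1 *: a) d01) Pc.
exists n0; suff near_le n m : (n0 <= n)%N -> (n <= m)%N ->
    cone_ll P (d (u n) (u m)) c.
  move=> n m n0n n0m; have [nm|/ltnW mn] := leqP n m; first exact: near_le.
  by rewrite sym; exact: near_le.
move=> n0n /subnKC <-.
apply: (cone_le_ll_trans coneP _ _ _ _ (un0 n n0n)).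
exact: cone_dist_geometric.
Qed.

End ConeMetricLimits.

Lemma normal_cone_squeeze0 {R : realType} {E : completeNormedModType R}
    (P : set E) (u v : nat -> E) : normal_cone P ->
  (forall n, cone_le P 0 (u n)) -> (forall n, cone_le P (u n) (v n)) ->
  v n @[n --> \oo] --> (0 : E) -> u n @[n --> \oo] --> (0 : E).
Proof.
move=> [K [K0 Kle]] u0 uv v0; apply/norm_cvg0P.
have Kv0 : K * `|v n| @[n --> \oo] --> (0 : R).
  rewrite -[X in _ --> X](mulr0 K); apply: cvgM; first exact: cvg_cst.
  exact/norm_cvg0P.
apply: (squeeze_cvgr _ (cvg_cst 0) Kv0).
by apply: nearW => n; rewrite normr_ge0 Kle.
Qed.

(** * Picard iterates of a weak contraction *)

Section WeakContraction.
Context {R : realType} {E : completeNormedModType R} {M : Type}.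
Context {P : set E} {d : M -> M -> E} {T S : M -> M}.
Hypotheses (coneP : is_cone P) (metric_d : is_cone_metric P d).

(** For [x = iter n S x0] and [y = S x], the [L] term of the inequality is a
    multiple of [d (T y) (T y)], hence zero. *)
Lemma weak_contraction_orbit (delta L : R) x0 n : 0 <= delta ->
  (forall x y, cone_le P (d (T (S x)) (T (S y)))
      (delta *: d (T x) (T y) + L *: d (T y) (T (S x)))) ->
  cone_le P (d (T (iter n S x0)) (T (iter n.+1 S x0)))
    (delta ^+ n *: d (T x0) (T (S x0))).
Proof.
have [_ eq0 _ _] := metric_d.
move=> d0 TS; elim: n => [|n IH].
  by rewrite expr0 scale1r; exact: cone_le_refl.
have := TS (iter n S x0) (iter n.+1 S x0).
rewrite [X in L *: X](_ : _ = 0); last exact/eq0.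
rewrite scaler0 addr0 => /(cone_le_trans coneP); apply.
by rewrite exprS -scalerA; exact: cone_leZ.
Qed.

(** Continuity of [S] and [T] makes both [T z] and [T (S z)] limits of
    subsequences of the convergent sequence [T (iter n S x0)], along [phi n] and
    [(phi n).+1]; they agree, and injectivity of [T] cancels it. *)
Lemma orbit_limit_fixed x0 y0 z (phi : nat -> nat) : interior P !=set0 ->
  cone_continuous P d T -> injective T -> cone_continuous P d S ->
  {homo phi : m n / (m < n)%N} ->
  cone_cvg_to P d (fun n => T (iter n S x0)) y0 ->
  cone_cvg_to P d (fun n => iter (phi n) S x0) z -> S z = z.
Proof.
move=> intP contT injT contS phiS Ty xz; apply: injT.
apply: (@cone_cvg_to_unique _ _ _ _ _ coneP metric_d
  (fun n => T (iter (phi n).+1 S x0))) => //; first exact/contT/contS.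
suff -> : T z = y0.
  exact: (cone_cvg_to_subseq _ _ _ phiS (cone_cvg_to_shift _ _ Ty)).
apply: (@cone_cvg_to_unique _ _ _ _ _ coneP metric_d
  (fun n => T (iter (phi n) S x0))) => //; first exact: contT.
exact: (cone_cvg_to_subseq _ _ _ phiS Ty).
Qed.

End WeakContraction.

Theorem theorem3p4 (R : realType) (E : completeNormedModType R)
    (P : set E) (K : R) (M : Type) (d : M -> M -> E) (T S : M -> M)
    (coneP : is_cone P) (intP : interior P !=set0)
    (normP : normal_cone P) (constP : normal_constant P K)
    (M_nonempty : inhabited M)
    (metric_d : is_cone_metric P d) (complete_d : cone_complete P d)
    (contT : cone_continuous P d T) (injT : injective T)
    (contS : cone_continuous P d S) (contrS : weak_contraction P d T S) :
  [/\ (* (i) *)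
      forall x0 : M,
        d (T (iter n S x0)) (T (iter n.+1 S x0)) @[n --> \oo] --> (0 : E),
      (* (ii) *)
      forall x0 : M, exists y0 : M,
        cone_cvg_to P d (fun n : nat => T (iter n S x0)) y0,
      (* (iii) *)
      subsequentially_convergent P d T ->
        forall x0 : M, has_cvg_subsequence P d (fun n : nat => iter n S x0),
      (* (iv) *)
      subsequentially_convergent P d T ->
        exists z0 : M, S z0 = z0
    & (* (v) *)
      sequentially_convergent P d T ->
        forall x0 : M, exists z0 : M,
          S z0 = z0 /\ cone_cvg_to P d (fun n : nat => iter n S x0) z0].
Proof.
have [delta [L [d01 _ TS]]] := contrS; have /andP[d0 _] := d01.
have [ge0 _ _ _] := metric_d.
have orbit_le x0 n : cone_le P (d (T (iter n S x0)) (T (iter n.+1 S x0)))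
    (delta ^+ n *: d (T x0) (T (S x0))).
  by apply: (weak_contraction_orbit coneP metric_d _ _ _ _ _ TS); exact: ltW.
have T_orbit_cvg x0 : exists y0 : M,
    cone_cvg_to P d (fun n : nat => T (iter n S x0)) y0.
  apply: complete_d.
  apply: (cone_cauchy_geometric coneP metric_d _ _ _ d01 _ (orbit_le x0)).
  exact: ge0.
split=> //.
- move=> x0; apply: (normal_cone_squeeze0 _ _ _ normP _ (orbit_le x0)) => //.
  exact: cvg_exprZ0.
- by move=> subT x0; apply: subT; exact: T_orbit_cvg.
- move=> subT; have [x0] := M_nonempty; have [y0 Ty] := T_orbit_cvg x0.
  have [phi phiS [z xz]] := subT _ (T_orbit_cvg x0).
  by exists z; apply: (orbit_limit_fixed coneP metric_d _ _ _ _ intP) Ty xz.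
- move=> seqT x0; have [y0 Ty] := T_orbit_cvg x0.
  have [z xz] := seqT _ (T_orbit_cvg x0); exists z; split=> //.
  by apply: (orbit_limit_fixed coneP metric_d _ _ _ id intP) Ty xz.
Qed.
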